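(* Consider the Basic Independence Model, let $0<\lambda<\gamma_1\le\dots\le\gamma_k\le1$ and $0<\alpha<\lambda$, and let $\mathcal F_{\gamma_i}=\sigma((\hat F_n(t))_{t\ge\gamma_i})$ be the generated $\sigma$-algebra, $i=1,\dots,k$. Let $\hat\beta_1,\dots,\hat\beta_k$ be non-negative, data dependent weights with $\sum_{i=1}^k\hat\beta_i=1$ such that $\hat\beta_i$ is $\mathcal F_{\gamma_i}$-measurable for each $i$. Moreover, let $\widetilde n_0(\gamma_i)$, $i=1,\dots,k$, be estimators, each a strictly positive measurable function of $(\hat F_n(t))_{t\ge\lambda}$, which satisfy $$E\left(\frac{V(\lambda)}{\widetilde n_0(\gamma_i)}\,\Big|\,\mathcal F_{\gamma_i}\right)\le\lambda,\qquad i=1,\dots,k$$ (this includes the generalized Storey estimators $\hat n_0(\lambda_i,\gamma_i)$ with $\lambda\le\lambda_i<\gamma_i$). Then the estimator $$\hat n_0=\sum_{i=1}^k\hat\beta_i\,\widetilde n_0(\gamma_i)$$ satisfies $E\left(\frac{V(\lambda)}{\hat n_0}\right)\le\lambda$, and the adaptive step up test with critical values $\hat\alpha_{i:n}=\left(\frac{i}{\hat n_0}\alpha\right)\wedge\lambda$, $i=1,\dots,n$, has $FDR\le\alpha$.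
   Context: Basic Independence (BI) Model: $n\ge 1$ null hypotheses $\mathcal H_1,\dots,\mathcal H_n$; $(H_i,\xi_i)_{i\le n}$ is an arbitrary random vector with values in $(\{0,1\}\times[0,1])^n$; $U_1,\dots,U_n$ are independent, uniformly distributed on $(0,1)$, and independent of $(H_i,\xi_i)_{i\le n}$. $\mathcal H_i$ is true if $H_i=0$ and false if $H_i=1$. The $p$-values are $p_i=(1-H_i)U_i+H_i\xi_i$. Put $N_0=\sum_{i=1}^n(1-H_i)$ and assume $E(N_0)>0$. Let $\hat F_n(t)=\frac1n\sum_{i=1}^n 1\{p_i\le t\}$, $t\in[0,1]$, and let $p_{1:n}\le\dots\le p_{n:n}$ be the order statistics of the $p$-values. Notation: $a\wedge b=\min(a,b)$, $a\vee b=\max(a,b)$. For $t\in[0,1]$: $V(t)=\sum_{i=1}^n 1\{p_i\le t,H_i=0\}$. Generalized Storey estimator, for $\lambda\le\lambda_i<\gamma_i\le1$: $$\hat n_0(\lambda_i,\gamma_i)=n\,\frac{\hat F_n(\gamma_i)-\hat F_n(\lambda_i)+\frac1n}{\gamma_i-\lambda_i}.$$ Adaptive step up (SU) test with data dependent critical values $0=\hat\alpha_{0:n}<\hat\alpha_{1:n}\le\dots\le\hat\alpha_{n:n}<1$: with $R=\max\{i: p_{i:n}\le\hat\alpha_{i:n}\}$ ($\max\emptyset=0$), it rejects all null hypotheses whose $p$-value is $\le\hat\alpha_{R:n}$; $R$ is the number of rejections. With $V=\sum_{i=1}^n 1\{p_i\le\hat\alpha_{R:n},H_i=0\}$, $FDR=E\left(\frac{V}{R\vee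 1}\right)$. Inequalities between conditional expectations and constants are understood almost surely. *)

(* Defs.v *)
From HB Require Import structures.
From mathcomp Require Import all_boot all_order all_algebra.
From mathcomp Require Import all_classical all_reals all_analysis measurable_realfun.

Set Implicit Arguments.
Unset Strict Implicit.
Unset Printing Implicit Defensive.

Import Order.TTheory GRing.Theory Num.Theory.

Local Open Scope classical_set_scope.
Local Open Scope ring_scope.

(* Generators of sigma((X_i)_(i in D)); the sigma-algebra itself is
   <<s preimage_family D X >>. *)
Definition preimage_family (I T : Type) d (E : measurableType d)
    (D : set I) (X : I -> T -> E) : set (set T) :=
  \bigcup_(i in D) preimage_set_system setT (X i) measurable.

(* Measurability with respect to the sub-sigma-algebra generated by G; this is
   measurable_fun on g_sigma_algebraType G, without its pointedness
   requirement on T. *)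
Definition measurable_wrt (T : Type) d (E : measurableType d)
    (G : set (set T)) (f : T -> E) : Prop :=
  forall B, measurable B -> <<s G >> (f @^-1` B).

(* Y is a measurable function of the path (X_t)_(t in D). A measurable function
   on the path space is encoded as a g : (R -> R) -> R that is measurable for
   the sigma-algebra generated by the coordinates t in D; such a g depends only
   on the restriction of its argument to D. *)
Definition measurable_function_of (T : Type) (R : realType) (D : set R)
    (X : R -> T -> R) (Y : T -> R) : Prop :=
  exists2 g : (R -> R) -> R,
    measurable_wrt (preimage_family D (fun (t : R) (x : R -> R) => x t)) g &
    forall w, Y w = g (fun t => X t w).

Section independence.
Context d (T : measurableType d) (R : realType) (P : probability T R).

Definition mutually_independent (I : finType) d' (E : measurableType d')
    (X : I -> {RV P >-> E}) : Prop :=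
  forall (J : {set I}) (B : I -> set E), (forall i, measurable (B i)) ->
    P (\bigcap_(i in [set` J]) X i @^-1` B i)
    = (\prod_(i in J) P (X i @^-1` B i))%E.

Definition independent_sigma (F G : set (set T)) : Prop :=
  forall A B, F A -> G B -> (P (A `&` B) = P A * P B)%E.

End independence.

Section conditional_expectation.
Context d (T : measurableType d) (R : realType) (P : probability T R).

(* Y is a version of E(X | sigma(G)), for a nonnegative X which need not be
   integrable. *)
Definition is_ge0_cond_expectation (G : set (set T)) (X Y : T -> \bar R)
    : Prop :=
  [/\ measurable_wrt G Y,
      (forall w, (0 <= Y w)%E) &
      forall A, <<s G >> A ->
        (\int[P]_(w in A) Y w = \int[P]_(w in A) X w)%E].

Definition ge0_cond_expectation_le (G : set (set T)) (X : T -> R) (c : R)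
    : Prop :=
  exists Y : T -> \bar R,
    is_ge0_cond_expectation G (fun w => (X w)%:E) Y
    /\ {ae P, forall w, (Y w <= c%:E)%E}.

End conditional_expectation.

Section model.
Context d (T : measurableType d) (R : realType) (P : probability T R) (n : nat).
Variables (H : 'I_n -> {RV P >-> bool}) (xi U : 'I_n -> {RV P >-> R}).

Definition nb_true_nulls (w : T) : nat := (\sum_(i < n) ~~ H i w)%N.

(* H i w = true means that the i-th null hypothesis is false. *)
Record basic_independence : Prop := BasicIndependence {
  xi_itv : forall i w, 0 <= xi i w <= 1 ;
  U_uniform : forall i A, measurable A ->
    distribution P (U i) A = uniform_prob (@ltr01 R) A ;
  U_independent : mutually_independent U ;
  U_independent_Hxi :
    independent_sigma P
      <<s preimage_family [set: 'I_n] U >>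
      <<s preimage_family [set: 'I_n] (fun i w => (H i w, xi i w)) >> ;
  nb_true_nulls_gt0 : (0 < 'E_P[fun w => (nb_true_nulls w)%:R%R])%E }.

Definition pvalue (i : 'I_n) (w : T) : R :=
  (1 - (H i w)%:R) * U i w + (H i w)%:R * xi i w.

Definition ecdf (t : R) (w : T) : R :=
  n%:R^-1 * \sum_(i < n) (pvalue i w <= t)%R%:R.

Definition ecdf_gen (t : R) : set (set T) := preimage_family `[t, 1] ecdf.

(* p_{j:n}, for 1 <= j <= n *)
Definition order_stat (j : nat) (w : T) : R :=
  nth 0 (sort <=%R [seq pvalue i w | i <- enum 'I_n]) j.-1.

Definition false_rejections (t : R) (w : T) : nat :=
  (\sum_(i < n) ((pvalue i w <= t)%R && ~~ H i w))%N.

Definition storey_estimator (lambda gamma : R) (w : T) : R :=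
  n%:R * ((ecdf gamma w - ecdf lambda w + n%:R^-1) / (gamma - lambda)).

Definition conservative_estimator (lambda gamma : R) (m : T -> R) : Prop :=
  [/\ forall w, 0 < m w,
      measurable_function_of `[lambda, 1] ecdf m &
      ge0_cond_expectation_le P (ecdf_gen gamma)
        (fun w => (false_rejections lambda w)%:R / m w) lambda].

(* A step up test is given by its critical values c : nat -> T -> R, where c j
   is the j-th one for 1 <= j <= n, and c 0 = 0. *)
Definition su_rejections (c : nat -> T -> R) (w : T) : nat :=
  (\max_(1 <= j < n.+1 | (order_stat j w <= c j w)%R) j)%N.

Definition FDR (c : nat -> T -> R) : \bar R :=
  ('E_P[fun w => ((false_rejections (c (su_rejections c w) w) w)%:R
                  / (maxn (su_rejections c w) 1)%:R)%R])%E.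

(* At j = 0 this is 0 when 0 < lambda. *)
Definition adaptive_critical_value (m : T -> R) (alpha lambda : R)
    (j : nat) (w : T) : R :=
  Num.min (j%:R / m w * alpha) lambda.

End model.

(* Main.v *)
(* Leave one out: for a fixed i, U_i is independent of everything else (all_but),
   and on {H_i = 0, U_i <= t} with t >= 0 replacing p_i by 0 changes neither the
   empirical distribution function beyond t nor, for t = c_R the critical value
   reached, the number R of rejections. Fubini in the variable U_i then gives
   two things. Firstly, in the expectation of V(lambda) over the Storey estimator,
   1{U_i <= lambda} can be exchanged for
   lambda / (gamma - lambda_i) 1{lambda_i < U_i <= gamma}, and these indicators
   sum up to at most the number of p-values in (lambda_i, gamma]. Secondly,
   FDR <= alpha / lambda E(V(lambda) / n0) for every estimator n0 that is a
   function of the empirical distribution function on [lambda, 1]. The mixed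
   estimator is handled by convexity of the inverse,
   1 / sum_i beta_i m_i <= sum_i beta_i / m_i, and conditioning. *)

Require Import Defs.
From HB Require Import structures.
From mathcomp Require Import all_boot all_order all_algebra.
From mathcomp Require Import all_classical all_reals all_analysis measurable_realfun.
From mathcomp Require Import ring.
Import Order.TTheory GRing.Theory Num.Theory.
Local Open Scope classical_set_scope.
Local Open Scope ring_scope.

Set Implicit Arguments.
Unset Strict Implicit.
Unset Printing Implicit Defensive.

(** * Sub-sigma-algebras and independence *)

Lemma measurable_wrtE (T : pointedType) d' (E : measurableType d')
    (G : set (set T)) (f : T -> E) :
  measurable_wrt G f <-> measurable_fun [set: g_sigma_algebraType G] f.
Proof.
split=> [mf _ B mB|mf B mB]; first by rewrite setTI; exact: mf.
by rewrite -[_ @^-1` _]setTI; exact: (mf measurableT).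
Qed.

Section sub_sigma_algebra.
Context d (T : measurableType d) (R : realType) (P : probability T R).
Variables (G : set (set T)) (mG : G `<=` measurable).
Local Notation TG := (g_sigma_algebraType G).

Lemma sub_measurable : <<s G >> `<=` measurable.
Proof. by apply: smallest_sub => //; exact: sigma_algebra_measurable. Qed.

Lemma sub_measurable_fun d' (E : measurableType d') (f : T -> E) :
  measurable_fun [set: TG] f -> measurable_fun [set: T] f.
Proof. by move=> mf _ B mB; apply: sub_measurable; exact: (mf measurableT). Qed.

Let mid : measurable_fun [set: T] (fun w : T => w : TG).
Proof. by move=> _ B mB; rewrite setTI; exact: sub_measurable. Qed.

Let idG : {mfun T >-> TG} :=
  HB.pack (fun w : T => w : TG) (isMeasurableFun.Build _ _ _ _ _ mid).

(** The restriction of [P] to the sigma-algebra generated by [G], obtained as the law of the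
    identity map from [T] to [TG]. *)
Let Q : probability TG R := distribution P idG.

Let integral_sub (D : set T) (f : T -> \bar R) : <<s G >> D ->
  measurable_fun [set: TG] f -> (forall w, 0 <= f w)%E ->
  (\int[Q]_(w in D) f w = \int[P]_(w in D) f w)%E.
Proof.
move=> mD mf f0; rewrite ge0_integral_pushforward//.
exact: (@measurable_funTS _ _ TG).
Qed.

Section independent_variable.
Variables (U : {RV P >-> R}) (nu : probability R R).
Hypotheses (GI : setI_closed G) (GT : G setT).
Hypothesis indep : forall A B, G A -> measurable B ->
  P (A `&` U @^-1` B) = (P A * nu B)%E.

(** For fixed [B], both sides are finite measures in [A] that agree on the pi-system [G], hence on
    the sigma-algebra it generates. *)
Let indep_sigma A B : <<s G >> A -> measurable B ->
  P (A `&` U @^-1` B) = (P A * nu B)%E.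
Proof.
move=> sA mB.
have mUB : measurable (U @^-1` B) by rewrite -[_ @^-1` _]setTI; exact: measurable_funP.
have nuB : nu B \is a fin_num by exact: fin_num_measure.
pose c : {nonneg R} := NngNum (fine_ge0 (measure_ge0 nu B)).
have : mrestr P mUB A = mscale c P A.
  apply: (@g_sigma_algebra_measure_unique _ R T G mG (fun=> setT) (fun=> GT)).
  - by rewrite bigcup_const.
  - exact: GI.
  - move=> C GC; change (P (C `&` U @^-1` B) = c%:num%:E * P C)%E.
    by rewrite indep//= fineK// muleC.
  - move=> _; change (P (setT `&` U @^-1` B) < +oo)%E.
    by rewrite setTI; apply: (le_lt_trans (probability_le1 P mUB)); rewrite ltry.
  - exact: sA.
change (P (A `&` U @^-1` B) = c%:num%:E * P A -> P (A `&` U @^-1` B) = P A * nu B)%E.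
by move=> ->; rewrite /= fineK// muleC.
Qed.

Let mZ : measurable_fun [set: T] (fun w => (w : TG, U w)).
Proof. by apply: measurable_fun_pair; [exact: mid|exact: measurable_funP]. Qed.

Let Z : {mfun T >-> (TG * R)%type} :=
  HB.pack (fun w => (w : TG, U w))
    (isMeasurableFun.Build _ _ _ _ _ mZ).

(** Independence says that the law of [w |-> (w, U w)] on [TG * R] is a product measure, so
    Tonelli's theorem applies. Measurability of [F] over [TG * R] expresses that its first argument
    enters only through the information in [G]. *)
Lemma independent_fubini (F : T * R -> \bar R) :
  measurable_fun [set: TG * R] F -> (forall x, 0 <= F x)%E ->
  (\int[P]_w F (w, U w) = \int[P]_w \int[nu]_u F (w, u))%E.
Proof.
move=> mF F0; rewrite -(@ge0_integral_distribution _ _ _ _ _ _ Z)//.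
rewrite -integral_sub//; last 3 first.
- exact: sub_sigma_algebra.
- exact: (@measurable_fun_fubini_tonelli_F _ _ TG R R nu).
- by move=> w; exact: integral_ge0.
transitivity (\int[Q]_x fubini_F nu F x)%E; last by [].
rewrite -(fubini_tonelli1 (m1 := Q) (m2 := nu))//.
(* A product measure is determined by its values on rectangles, which [indep_sigma] gives. *)
apply: eq_measure_integral => A mA _; apply/esym.
by apply: product_measure_unique.
Qed.

End independent_variable.
End sub_sigma_algebra.

(** * Uniform distribution and bounded conditional expectations *)

Section uniform01.
Variable R : realType.
Local Notation unif := (uniform_prob (@ltr01 R)).

Lemma uniform_prob01E (A : set R) : measurable A ->
  unif A = lebesgue_measure (A `&` `[0, 1]).
Proof.
move=> mA; rewrite /uniform_prob integral_uniform_pdf.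
rewrite (eq_integral (fun=> 1%:E)); last first.
  move=> u /[!inE] -[_]; rewrite /= in_itv/= /uniform_pdf => ->.
  by rewrite subr0 invr1.
by rewrite integral_cst ?mul1e//; exact: measurableI.
Qed.

Lemma uniform_prob01_le (c : R) : 0 <= c <= 1 -> unif `]-oo, c] = c%:E.
Proof.
move=> /andP[c0 c1]; rewrite uniform_prob01E//.
have -> : `]-oo, c] `&` `[0, 1] = `[0, c]%classic.
  apply/seteqP; split=> x /=; rewrite !in_itv/=.
    by move=> [-> /andP[-> _]].
  by move=> /andP[-> xc]; rewrite xc (le_trans xc c1).
rewrite lebesgue_measure_itv/= lte_fin.
by move: c0; rewrite le_eqVlt => /predU1P[<-|->]; rewrite ?ltxx// sube0.
Qed.

Lemma uniform_prob01_lt (c : R) : 0 <= c <= 1 -> unif `]-oo, c[ = c%:E.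
Proof.
move=> /andP[c0 c1]; rewrite uniform_prob01E//.
have -> : `]-oo, c[ `&` `[0, 1] = `[0, c[%classic.
  apply/seteqP; split=> x /=; rewrite !in_itv/=.
    by move=> [-> /andP[-> _]].
  by move=> /andP[-> xc]; rewrite xc (le_trans (ltW xc) c1).
rewrite lebesgue_measure_itv/= lte_fin.
by move: c0; rewrite le_eqVlt => /predU1P[<-|->]; rewrite ?ltxx// sube0.
Qed.

Lemma uniform_prob01_itv (a b : R) : 0 <= a -> a < b -> b <= 1 ->
  unif `]a, b] = (b - a)%:E.
Proof.
move=> a0 ab b1; rewrite uniform_prob01E// setIidl.
  by rewrite lebesgue_measure_itv/= lte_fin ab EFinB.
move=> x /=; rewrite !in_itv/= => /andP[ax xb].
by rewrite (le_trans a0 (ltW ax)) (le_trans xb b1).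
Qed.

End uniform01.

(** * Layer cake formula for a weight with values in [0, 1] *)

Section layer_cake.
Context d (T : measurableType d) (R : realType) (P : probability T R).
Variables (X b : T -> R) (nu : probability R R).
Hypotheses (mX : measurable_fun [set: T] X) (X0 : forall w, 0 <= X w).
Hypotheses (mb : measurable_fun [set: T] b) (b01 : forall w, 0 <= b w <= 1).
Hypothesis nu_lt : forall x : R, 0 <= x <= 1 -> nu `]-oo, x[%classic = x%:E.

Let D := [set z : T * R | z.2 < b z.1].

Let mD : measurable D.
Proof.
have : measurable_fun [set: T * R] (fun z => z.2 < b z.1).
  apply: measurable_fun_ltr; first exact: measurable_snd.
  exact: (measurableT_comp mb measurable_fst).
by move=> /(_ measurableT [set true]); rewrite setTI; exact.
Qed.

Let F (z : T * R) := (X z.1 * \1_D z)%:E.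

Let F0 z : (0 <= F z)%E.
Proof. by rewrite lee_fin mulr_ge0. Qed.

Let mF : measurable_fun [set: T * R] F.
Proof.
apply/measurable_EFinP; apply: measurable_funM.
  exact: (measurableT_comp mX measurable_fst).
exact: measurable_indic.
Qed.

Let sectionE u :
  (\int[P]_(w in [set w | (u < b w)%R]) (X w)%:E = \int[P]_w F (w, u))%E.
Proof.
rewrite integral_mkcond epatch_indic; apply: eq_integral => w _.
by rewrite /F /= EFinM !indicE !mem_setE.
Qed.

Lemma measurable_integral_superlevel : measurable_fun [set: R]
  (fun u => \int[P]_(w in [set w | (u < b w)%R]) (X w)%:E)%E.
Proof.
under eq_fun do rewrite sectionE.
exact: (@measurable_fun_fubini_tonelli_G _ _ _ _ _ P F mF F0).
Qed.

(** The weight [b w] is the [nu]-mass of []-oo, b w[]; Tonelli's theorem then exchanges the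
    integrals. *)
Lemma integral_layer_cake :
  (\int[P]_w (b w * X w)%:E =
   \int[nu]_u \int[P]_(w in [set w | (u < b w)%R]) (X w)%:E)%E.
Proof.
under [RHS]eq_integral do rewrite sectionE.
rewrite -(@fubini_tonelli _ _ _ _ _ P nu F mF F0).
apply: eq_integral => w _; rewrite /F/=.
under eq_integral do rewrite EFinM.
rewrite ge0_integralZl ?lee_fin//=; last first.
  apply/measurable_EFinP; apply: (measurableT_comp (f := (\1_D : T * R -> R))).
    exact: measurable_indic.
  exact: pair1_measurable.
rewrite EFinM muleC; congr (_ * _)%E.
by rewrite -(nu_lt (b01 w)) -[X in nu X]setIT -integral_indic.
Qed.

End layer_cake.

(** * Bounds on conditional expectations, tested on events *)

Section conditional_bound.
Context d (T : measurableType d) (R : realType) (P : probability T R).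
Variables (G : set (set T)) (mG : G `<=` measurable).
Local Notation TG := (g_sigma_algebraType G).
Variables (X : T -> R) (c : R).
Hypotheses (mX : measurable_fun [set: T] X) (X0 : forall w, 0 <= X w).

Lemma cond_expectation_le_integral A : 0 <= c ->
  ge0_cond_expectation_le P G X c -> <<s G >> A ->
  (\int[P]_(w in A) (X w)%:E <= c%:E * P A)%E.
Proof.
move=> c0 [Y [[/measurable_wrtE mY Y0 YE] Yc]] GA.
have mA := sub_measurable mG GA.
rewrite -YE// -integral_cst//; apply: ae_ge0_le_integral => //.
- by apply: measurable_funTS; exact: (sub_measurable_fun mG mY).
- by move: Yc; apply: filterS => w Ycw _.
Qed.

Hypotheses (c0 : 0 <= c)
  (Xc : forall A, <<s G >> A -> (\int[P]_(w in A) (X w)%:E <= c%:E * P A)%E).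

(** The superlevel sets of a [G]-measurable weight lie in the generated sigma-algebra, so [Xc]
    applies to each of them; the layer cake formula integrates these bounds over the level. *)
Lemma weighted_integral_le (nu : probability R R) (b : T -> R) :
  (forall x : R, 0 <= x <= 1 -> nu `]-oo, x[%classic = x%:E) -> measurable_wrt G b ->
  (forall w, 0 <= b w <= 1) ->
  (\int[P]_w (b w * X w)%:E <= c%:E * \int[P]_w (b w)%:E)%E.
Proof.
move=> nu_lt Gb b01; have /measurable_wrtE Gb' := Gb.
have mb := sub_measurable_fun mG Gb'.
have b0 w : 0 <= b w by case/andP: (b01 w).
rewrite (integral_layer_cake P mX X0 mb b01 nu_lt) -ge0_integralZl//=; last 2 first.
- exact/measurable_EFinP.
- by move=> w _; rewrite lee_fin.
(* The right-hand side is put in layer cake form too, with the constant [c] in the role of [X]. *)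
under [leRHS]eq_integral do rewrite -EFinM mulrC.
rewrite (integral_layer_cake P (measurable_cst c) (fun=> c0) mb b01 nu_lt).
apply: ge0_le_integral => //.
- by move=> u _; apply: integral_ge0 => w _; rewrite lee_fin.
- exact: measurable_integral_superlevel.
- exact: measurable_integral_superlevel.
move=> u _.
have sub : <<s G >> [set w | u < b w].
  have : measurable_fun [set: TG] (fun w => u < b w).
    exact: measurable_fun_ltr.
  by move=> /(_ measurableT [set true]); rewrite setTI; exact.
apply: (le_trans (Xc sub)).
by rewrite -integral_cst//; exact: (sub_measurable mG).
Qed.

(** The measure with density [X] with respect to [P], on the generated sigma-algebra only; [Xc]
    makes it finite. *)
Let density (A : set TG) : \bar R := (\int[P]_(w in A) (X w)%:E)%E.

Let density0 : density set0 = 0%E.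
Proof. by rewrite /density integral_set0. Qed.

Let density_ge0 A : (0 <= density A)%E.
Proof. by apply: integral_ge0 => w _; rewrite lee_fin. Qed.

Let density_sigma_additive : semi_sigma_additive density.
Proof.
move=> F mF tF mUF; rewrite /density; apply: cvg_toP.
  apply: ereal_nondecreasing_is_cvgn => i j ij.
  by apply: lee_sum_nneg_natr => // k _ _; exact: density_ge0.
rewrite (@ge0_integral_bigcup _ T)//=.
- by move=> k; apply: sub_measurable (mF k).
- exact/measurable_EFinP/measurable_funTS.
- by move=> w _; rewrite lee_fin.
Qed.

Let density_fin : fin_num_fun density.
Proof.
move=> A mA; rewrite ge0_fin_numE//; apply: (le_lt_trans (Xc mA)).
have mA' := sub_measurable mG mA.
by rewrite lte_mul_pinfty ?lee_fin// (le_lt_trans (probability_le1 P mA'))// ltry.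
Qed.

Let density_measure : {measure set TG -> \bar R} := HB.pack density
  (isMeasure.Build _ _ _ density density0 density_ge0 density_sigma_additive).

Let density_finite : {finite_measure set TG -> \bar R} :=
  HB.pack (Measure.sort density_measure)
    (@Measure_isFinite.Build _ TG R density_measure density_fin).

(** The Radon-Nikodym derivative [Y] of [density] with respect to the restriction of [P] is the
    conditional expectation, and it cannot exceed [c] on a set of positive mass without violating
    [Xc] there. *)
Lemma bounded_cond_expectation_le : ge0_cond_expectation_le P G X c.
Proof.
have mid : measurable_fun [set: T] (fun w : T => w : TG).
  by move=> _ B mB; rewrite setTI; exact: (sub_measurable mG).
pose Q : probability TG R := distribution P
  (HB.pack (fun w : T => w : TG) (isMeasurableFun.Build _ _ _ _ _ mid)).
have dom : density_finite `<< Q.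
  apply/null_content_dominatesP => A mA QA0; apply/eqP.
  rewrite eq_le measure_ge0 andbT; apply: (le_trans (Xc mA)).
  by move: QA0; rewrite /Q/= /distribution /pushforward/= => ->; rewrite mule0.
have [Y [Y0 Yfin /measurable_int mY YE]] := radon_nikodym_sigma_finite dom.
have mY' := sub_measurable_fun mG mY.
have YX A : <<s G >> A ->
    (\int[P]_(w in A) Y w = \int[P]_(w in A) (X w)%:E)%E.
  move=> mA; transitivity (density_finite A); last by [].
  rewrite YE// ge0_integral_pushforward//.
  exact: (@measurable_funTS _ _ TG).
exists Y; split; first by split=> //; exact/measurable_wrtE.
(* The exceptional set belongs to the generated sigma-algebra, so [Xc] can be tested on it. *)
pose A : set T := [set w | c%:E < Y w]%E; pose g (w : T) := (Y w - c%:E)%E.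
have GA : <<s G >> A.
  have := @emeasurable_fun_o_infty _ TG R setT Y measurableT mY c%:E.
  by rewrite setTI.
have mA := sub_measurable mG GA.
have mg : measurable_fun A g.
  by apply: measurable_funTS; apply: emeasurable_funB.
have g0 w : A w -> (0 <= g w)%E.
  by move=> Aw; rewrite sube_ge0//; exact: ltW.
(* The excess [g] is nonnegative on [A] and has integral at most 0 by [Xc]. It therefore vanishes
   almost everywhere on [A], although it is positive there. *)
have intg : (\int[P]_(w in A) `|g w| = 0)%E.
  under eq_integral => w /[!inE] Aw do rewrite gee0_abs ?g0//.
  apply/eqP; rewrite eq_le integral_ge0 // andbT.
  have PAfin : (c%:E * P A)%E \is a fin_num.
    by rewrite fin_numM// fin_num_measure.
  rewrite -(leeD2rE _ _ PAfin) add0e -[X in (_ + X)%E]integral_cst// -ge0_integralD//=.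
  under eq_integral do rewrite /g subeK//.
  by rewrite YX//; exact: Xc.
have /(ae_eq_integral_abs P mA mg) := intg.
apply: filterS => w Aw; rewrite leNgt; apply/negP => cY.
by move: (cY); rewrite -sube_gt0 -/(g w) Aw// ltxx.
Qed.

End conditional_bound.

(** * Functions of a path *)

Section path_space.
Variables (I : Type) (D : set I).

Definition coordinates d (E : measurableType d) : set (set (I -> E)) :=
  preimage_family D (fun (i : I) (x : I -> E) => x i).
Arguments coordinates {d} E.

(** Generators are preimages of generators under the path map, and generation commutes with
    preimages. Every event of the family thus says that the path lies in some measurable set. *)
Lemma preimage_family_path (T : Type) d (E : measurableType d)
    (X : I -> T -> E) :
  <<s preimage_family D X >> = preimage_set_system setT (fun w i => X i w)
    <<s coordinates E >>.
Proof.
rewrite -(@g_sigma_preimageE T (I -> E)); congr (<<s _ >>).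
apply/seteqP; split=> A /=.
  move=> [i Di [B mB <-]]; exists [set x | B (x i)]; last by rewrite !setTI.
  by exists i => //; exists B => //; rewrite setTI.
move=> [C [i Di [B mB <-]] <-]; exists i => //; exists B => //.
by rewrite !setTI.
Qed.

Lemma measurable_wrt_path (T : Type) d (E : measurableType d)
    d' (E' : measurableType d') (X : I -> T -> E) (g : (I -> E) -> E') :
  measurable_wrt (coordinates E) g ->
  measurable_wrt (preimage_family D X) (fun w => g (fun i => X i w)).
Proof.
move=> mg B mB; rewrite preimage_family_path.
by exists (g @^-1` B); [exact: mg|rewrite setTI].
Qed.

(** The sets that do not separate [x] from [y] form a sigma-algebra containing the generators. *)
Lemma coordinates_saturated d (E : measurableType d) (A : set (I -> E)) x y :
  <<s coordinates E >> A -> (forall i, D i -> x i = y i) -> A x <-> A y.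
Proof.
move=> mA xy; pose saturated := [set A : set (I -> E) | A x <-> A y].
suff : <<s coordinates E >> `<=` saturated by exact.
apply: smallest_sub.
  split=> //= [B Bxy|F Fxy].
    by split=> -[_ nB]; split=> // /Bxy.
  by split=> -[n _ /Fxy ?]; exists n.
by move=> _ [i Di [B mB <-]]; rewrite /saturated/= xy.
Qed.

Lemma coordinates_fun_eq (R : realType) d (E : measurableType d)
    (g : (I -> E) -> R) x y :
  measurable_wrt (coordinates E) g -> (forall i, D i -> x i = y i) ->
  g x = g y.
Proof.
move=> mg xy; have := coordinates_saturated (mg [set g x] (measurable_set1 _)) xy.
by move=> [/(_ erefl)].
Qed.

End path_space.
Arguments coordinates {I} D {d} E.

Lemma preimage_family_measurable (I : Type) d (S : measurableType d)
    d' (E : measurableType d') (D : set I) (X : I -> S -> E) :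
  (forall i, D i -> measurable_fun setT (X i)) ->
  preimage_family D X `<=` measurable.
Proof. by move=> mX _ [i Di [B mB <-]]; exact: mX. Qed.

Lemma preimage_familyS (I T : Type) d' (E : measurableType d') (D D' : set I)
    (X : I -> T -> E) :
  D `<=` D' -> preimage_family D X `<=` preimage_family D' X.
Proof. by move=> DD' A [i /DD' D'i ?]; exists i. Qed.

(* Doob-Dynkin: f is the supremum over rationals q of q * 1_{f > q}, and each
   event {f > q} is the preimage of a measurable set of paths. *)
Lemma measurable_factorization (T : Type) (R : realType) (D : set R)
    (X : R -> T -> R) (f : T -> R) : (forall w, 0 <= f w) ->
  measurable_wrt (preimage_family D X) f -> measurable_function_of D X f.
Proof.
move=> f0 mf; pose path w := (fun t => X t w).
(* An enumeration of the rationals. An index that encodes none defaults to 0 and contributes the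
   value 0 to the supremum, which is harmless since [f] is nonnegative. *)
pose q n : R := ratr (odflt 0 (unpickle n : option rat)).
have /choice[B mB] : forall n, exists B : set (R -> R),
    <<s coordinates D R >> B /\ path @^-1` B = [set w | q n < f w].
  move=> n; have := mf `]q n, +oo[%classic (measurable_itv _).
  rewrite preimage_family_path => -[B mB BE]; exists B; split=> //.
  by rewrite setTI in BE; rewrite BE set_itvE.
pose PT := g_sigma_algebraType (coordinates D R).
pose u (n : nat) (x : PT) : \bar R := (q n * \1_(B n) x)%:E.
(* Off the range of [path] the supremum may be infinite; [fine] then gives the value 0. *)
pose g (x : PT) : R := fine (ereal_sup (range (u ^~ x))).
have mg : measurable_fun [set: PT] g.
  apply: (measurableT_comp (f := fine)) => //.
  have -> : (fun x : PT => ereal_sup (range (u ^~ x))) =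
      (fun x => esups (u ^~ x) 0%N).
    apply/funext => x; rewrite /esups/=; congr ereal_sup.
    by apply/seteqP; split=> _ [n _ <-]; exists n.
  apply: measurable_fun_esups => n; apply/measurable_EFinP.
  apply: measurable_funM => //; apply: measurable_indic.
  exact: (mB n).1.
exists g; first by move=> C mC; have := mg measurableT C mC; rewrite setTI.
move=> w; rewrite /g; suff -> : ereal_sup (range (u ^~ (path w))) = (f w)%:E by [].
have uE n : u n (path w) = (q n * (q n < f w)%R%:R)%:E.
  rewrite /u indicE; congr (_ * _%:R)%:E; congr nat_of_bool.
  have [_ BE] := mB n.
  by apply/idP/idP; rewrite -[path w \in B n]/(w \in path @^-1` B n) BE inE.
apply/eqP; rewrite eq_le; apply/andP; split.
  apply: ub_ereal_sup => _ [n _ <-]; rewrite uE lee_fin.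
  by case: ltP => [/ltW|_]; rewrite ?mulr1 ?mulr0.
rewrite leNgt; apply/negP => supf.
have ub n : (u n (path w) <= ereal_sup (range (u ^~ (path w))))%E.
  by apply: ereal_sup_ubound; exists n.
have := ub 0%N; move: supf ub.
case: (ereal_sup _) => [s| |]; rewrite ?ltNge ?leey ?leeNy_eq// => + ub _.
(* A rational [r] strictly between [s] and [f w] is the value of the term of index [pickle r],
   against [s] being an upper bound. *)
rewrite -ltNge lte_fin => /rat_in_itvoo[r]; rewrite in_itv/= => /andP[sr rf].
have := ub (pickle r); rewrite uE /q pickleK/= rf mulr1 lee_fin.
by rewrite leNgt sr.
Qed.

(** * Independence of one p-value from the others *)

Lemma measurable_natr_bool (R : realType) d (S : measurableType d)
    (b : S -> bool) : measurable_fun setT b ->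
  measurable_fun setT (fun s => (b s)%:R : R).
Proof.
by move=> mb; apply: (measurableT_comp (f := fun b : bool => b%:R : R)).
Qed.

Section leave_one_out.
Context d (T : measurableType d) (R : realType) (P : probability T R) (n : nat).
Variables (H : 'I_n -> {RV P >-> bool}) (xi U : 'I_n -> {RV P >-> R}).
Hypothesis BI : basic_independence H xi U.
Variable i : 'I_n.

Let HX := preimage_family [set: 'I_n] (fun j w => (H j w, xi j w)).

Let UB (J : set 'I_n) (B : 'I_n -> set R) := \bigcap_(j in J) U j @^-1` B j.

(* A pi-system generating the sigma-algebra of (H_j, xi_j)_j and (U_j)_(j != i). *)
Definition all_but : set (set T) :=
  [set C | exists A B, [/\ <<s HX >> A, forall j, measurable (B j) &
                        C = A `&` UB [set j | j != i] B]].
Local Notation TG := (g_sigma_algebraType all_but).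

Let measurable_HX : <<s HX >> `<=` measurable.
Proof.
have mHX j : [set: 'I_n] j -> measurable_fun setT (fun w => (H j w, xi j w)).
  by move=> _; apply: measurable_fun_pair; exact: measurable_funP.

exact: (sub_measurable (preimage_family_measurable mHX)).
Qed.

Let measurable_UB J B : (forall j, measurable (B j)) -> measurable (UB J B).
Proof.
move=> mB; apply: fin_bigcap_measurable => [|j _]; first exact: finite_finset.
by rewrite -[_ @^-1` _]setTI; exact: measurable_funP.
Qed.

Let sigma_UB J B : (forall j, measurable (B j)) ->
  <<s preimage_family [set: 'I_n] U >> (UB J B).
Proof.
move=> mB.
pose TU := g_sigma_algebraType (preimage_family [set: 'I_n] U).
apply: (@fin_bigcap_measurable _ TU) => [|j _]; first exact: finite_finset.
by apply: sub_sigma_algebra; exists j => //; exists (B j) => //; rewrite setTI.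
Qed.

Lemma all_but_measurable : all_but `<=` measurable.
Proof.
move=> _ [A [B [sA mB ->]]]; apply: measurableI; first exact: measurable_HX.
exact: measurable_UB.
Qed.

Lemma all_but_setI : setI_closed all_but.
Proof.
move=> _ _ [A [B [sA mB ->]]] [A' [B' [sA' mB' ->]]].
exists (A `&` A'), (fun j => B j `&` B' j); split.
- exact: (@measurableI _ (g_sigma_algebraType HX)).
- by move=> j; exact: measurableI.
- by rewrite setIACA; congr (_ `&` _); rewrite /UB -bigcapI.
Qed.

Lemma all_but_setT : all_but setT.
Proof.
exists setT, (fun=> setT); split => //.
  exact: (@measurableT _ (g_sigma_algebraType HX)).
by rewrite setTI; apply/seteqP; split.
Qed.

(** Independence of [U] from [(H, xi)] splits off the event [A]; mutual independence then evaluates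
    both rectangles of uniforms as products, which differ exactly by the factor of index [i]. *)
Lemma all_but_independent C B : all_but C -> measurable B ->
  P (C `&` U i @^-1` B) = (P C * distribution P (U i) B)%E.
Proof.
move=> [A [B' [sA mB' ->]]] mB.
have [_ _ Uindep HXindep _] := BI.
(* Inserting [B] in slot [i] merges all constraints on the uniforms into a single rectangle over all
   indices. *)
pose B'' j := if j == i then B else B' j.
have mB'' j : measurable (B'' j) by rewrite /B''; case: ifP.
have -> : A `&` UB [set j | j != i] B' `&` U i @^-1` B = UB setT B'' `&` A.
  apply/seteqP; split=> w.
    move=> [[Aw B'w] Bw]; split=> // j _; rewrite /B''/=.
    by case: eqP => [->|/eqP ji]//; exact: B'w.
  move=> [Bw Aw]; split; first split=> //.
    by move=> j /= ji; have := Bw j I; rewrite /B'' (negbTE ji).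
  by have := Bw i I; rewrite /B'' eqxx.
rewrite HXindep//; last exact: sigma_UB.
rewrite [A `&` _]setIC HXindep//; last exact: sigma_UB.
have -> : P (UB setT B'') = (\prod_(j < n) P (U j @^-1` B'' j))%E.
  have := Uindep finset.setT B'' mB''.
  rewrite (_ : [set` finset.setT] = setT); last first.
    by apply/seteqP; split=> j //=; rewrite inE.
  by move=> ->; apply: eq_bigl => j; rewrite inE.
have -> : P (UB [set j | j != i] B') = (\prod_(j < n | j != i) P (U j @^-1` B' j))%E.
  have := Uindep (finset.setC (finset.set1 i)) B' mB'.
  rewrite (_ : [set` finset.setC _] = [set j | j != i]); last first.
    by apply/seteqP; split=> j /=; rewrite !inE.
  by move=> ->; apply: eq_bigl => j; rewrite !inE.
rewrite (bigD1 i)//= /B'' eqxx [RHS]muleAC; congr (_ * _)%E.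
rewrite muleC; congr (_ * _)%E.
by apply: eq_bigr => j /negbTE ->.
Qed.

Let all_but_fun d' (E : measurableType d') (X : T -> E) :
  (forall B, measurable B -> all_but (X @^-1` B)) ->
  measurable_fun [set: TG] X.
Proof. by move=> mX _ B mB; rewrite setTI; apply: sub_sigma_algebra; exact: mX. Qed.

Let all_but_HX j : measurable_fun [set: TG] (fun w => (H j w, xi j w)).
Proof.
apply: all_but_fun => // B mB.
exists ((fun w => (H j w, xi j w)) @^-1` B), (fun=> setT); split=> //.
  by apply: sub_sigma_algebra; exists j => //; exists B => //; rewrite setTI.
by rewrite (_ : UB _ _ = setT) ?setIT//; apply/seteqP; split.
Qed.

Lemma all_but_H j : measurable_fun [set: TG] (H j).
Proof. exact: (measurableT_comp measurable_fst (all_but_HX j)). Qed.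

Let all_but_xi j : measurable_fun [set: TG] (xi j).
Proof. exact: (measurableT_comp measurable_snd (all_but_HX j)). Qed.

Let all_but_U j : j != i -> measurable_fun [set: TG] (U j).
Proof.
move=> ji; apply: all_but_fun => // B mB.
exists setT, (fun k => if k == j then B else setT); split.
- exact: (@measurableT _ (g_sigma_algebraType HX)).
- by move=> k; case: ifP.
- rewrite setTI; apply/seteqP; split=> w /=.
    by move=> Bw k _ /=; case: ifP => // /eqP ->.
  by move=> /(_ j ji); rewrite /= eqxx.
Qed.

Lemma all_but_pvalue j : j != i -> measurable_fun [set: TG] (pvalue H xi U j).
Proof.
move=> ji; have mH : measurable_fun [set: TG] (fun w => (H j w)%:R : R).
  exact: measurable_natr_bool (all_but_H j).
apply: measurable_funD; apply: measurable_funM.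
- by apply: measurable_funB; [exact: measurable_cst|exact: mH].
- exact: all_but_U.
- exact: mH.
- exact: all_but_xi.
Qed.

(** Given everything but [U i], the factor [K] is frozen and the indicator integrates to the mass of
    a section of [D]. *)
Lemma leave_one_out (K : T -> R) (D : set (T * R)) :
  measurable_fun [set: TG] K -> (forall w, 0 <= K w) ->
  measurable (D : set (TG * R)) ->
  (\int[P]_w (K w * \1_D (w, U i w))%:E =
   \int[P]_w ((K w)%:E * distribution P (U i) [set u | D (w, u)]))%E.
Proof.
move=> mK K0 mD; pose F (z : T * R) := (K z.1 * \1_D z)%:E.
have F0 z : (0 <= F z)%E by rewrite lee_fin mulr_ge0.
have mF : measurable_fun [set: TG * R] F.
  apply/measurable_EFinP; apply: measurable_funM.
    exact: (measurableT_comp mK measurable_fst).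
  exact: (@measurable_indic _ (TG * R)%type).
rewrite (independent_fubini all_but_measurable all_but_setI all_but_setT
  all_but_independent mF F0).
apply: eq_integral => w _; rewrite /F/=.
have mDw : measurable [set u | D (w, u)].
  by have := measurable_xsection (w : TG) mD; rewrite xsectionE.
under eq_integral do rewrite EFinM.
rewrite ge0_integralZl ?lee_fin//=; last exact/measurable_EFinP/measurable_indic.
by congr (_ * _)%E; rewrite -[X in distribution _ _ X]setIT -integral_indic.
Qed.

(** An independent uniform variable stays below a threshold in [0, 1] with probability equal to that
    threshold. Since [c] may depend on the rest of the sample, this covers data dependent critical
    values. *)
Lemma leave_one_out_le (K c : T -> R) :
  measurable_fun [set: TG] K -> (forall w, 0 <= K w) ->
  measurable_fun [set: TG] c -> (forall w, 0 <= c w <= 1) ->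
  (\int[P]_w (K w * (U i w <= c w)%R%:R)%:E = \int[P]_w (K w * c w)%:E)%E.
Proof.
move=> mK K0 mc c01; pose D := [set z : T * R | z.2 <= c z.1].
have mD : measurable (D : set (TG * R)).
  have : measurable_fun [set: TG * R] (fun z : TG * R => z.2 <= c z.1).
    apply: measurable_fun_ler; first exact: measurable_snd.
    exact: (measurableT_comp mc measurable_fst).
  by move=> /(_ measurableT [set true]); rewrite setTI; exact.
transitivity (\int[P]_w (K w * \1_D (w, U i w))%:E)%E.
  by apply: eq_integral => w _; rewrite indicE mem_setE.
rewrite leave_one_out//; apply: eq_integral => w _; rewrite EFinM.
have -> : [set u | D (w, u)] = `]-oo, c w]%classic by rewrite set_itvE.
by rewrite (U_uniform BI)// uniform_prob01_le.
Qed.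

Lemma leave_one_out_itv (K : T -> R) (a b : R) :
  measurable_fun [set: TG] K -> (forall w, 0 <= K w) ->
  0 <= a -> a < b -> b <= 1 ->
  (\int[P]_w (K w * (a < U i w <= b)%R%:R)%:E = \int[P]_w (K w * (b - a))%:E)%E.
Proof.
move=> mK K0 a0 ab b1; pose D := [set z : T * R | z.2 \in `]a, b]].
have mD : measurable (D : set (TG * R)).
  rewrite -[D]setTI; exact: (@measurable_snd _ _ TG R measurableT `]a, b]%classic).
transitivity (\int[P]_w (K w * \1_D (w, U i w))%:E)%E.
  by apply: eq_integral => w _; rewrite indicE mem_setE/= ?in_itv.
rewrite leave_one_out//; apply: eq_integral => w _; rewrite EFinM.
have -> : [set u | D (w, u)] = `]a, b]%classic by [].
by rewrite (U_uniform BI)// uniform_prob01_itv.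
Qed.

End leave_one_out.

(** * Empirical distribution functions and the Storey estimator *)

Section ecdf_of_sample.
Variables (R : realType) (n : nat).
Implicit Types (q : 'I_n -> R) (i : 'I_n) (t a b : R).

Definition ecdf_of q t : R := n%:R^-1 * \sum_(i < n) (q i <= t)%R%:R.

(** A sample freed of its [i]-th entry. The value 0 is below every threshold [t >= 0], so
    nonnegative thresholds from [q i] on see the same counts. *)
Definition zeroed i q : 'I_n -> R := fun j => if j == i then 0 else q j.

Lemma zeroed_le i q t : 0 <= t -> q i <= t ->
  forall j, (zeroed i q j <= t) = (q j <= t).
Proof. by move=> t0 qit j; rewrite /zeroed; case: eqP => // ->; rewrite t0 qit. Qed.

Lemma ecdf_of_zeroed i q t : 0 <= t -> q i <= t ->
  ecdf_of (zeroed i q) t = ecdf_of q t.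
Proof.
by move=> t0 qit; congr (_ * _); apply: eq_bigr => j _; rewrite zeroed_le.
Qed.

Definition storey_of a b q : R :=
  n%:R * ((ecdf_of q b - ecdf_of q a + n%:R^-1) / (b - a)).

Lemma storey_ofE a b q : (0 < n)%N -> a <= b ->
  storey_of a b q = (\sum_(j < n) (a < q j <= b)%R%:R + 1) / (b - a).
Proof.
move=> n0 ab; have nE : n%:R != 0 :> R by rewrite pnatr_eq0 -lt0n.
rewrite /storey_of /ecdf_of mulrA; congr (_ / _).
rewrite -mulrBr -[X in _ + X]mulr1 -mulrDr mulVKf// -sumrB; congr (_ + _).
apply: eq_bigr => j _; case: (ltP a (q j)) => qja.
  by rewrite subr0.
by rewrite (le_trans qja ab) subrr.
Qed.

Lemma storey_of_gt0 a b q : (0 < n)%N -> a < b -> 0 < storey_of a b q.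
Proof.
move=> n0 ab; rewrite storey_ofE ?(ltW ab)// divr_gt0 ?subr_gt0//.
by rewrite ltr_wpDl// sumr_ge0.
Qed.

Lemma storey_of_zeroed_le i q a b t : 0 <= t -> t <= a -> a <= b -> q i <= t ->
  storey_of a b (zeroed i q) = storey_of a b q.
Proof.
move=> t0 ta ab qit; rewrite /storey_of.
have a0 := le_trans t0 ta; have qia := le_trans qit ta.
by rewrite !ecdf_of_zeroed ?(le_trans a0 ab) ?(le_trans qia ab).
Qed.

(** Moving [q i] from the interval to 0 lowers the count by one, which cancels the summand [1]
    coming from the correction [n%:R^-1]. *)
Lemma storey_of_zeroed_itv i q a b : (0 < n)%N -> 0 <= a -> a < q i <= b ->
  storey_of a b (zeroed i q) = (\sum_(j < n) (a < q j <= b)%R%:R) / (b - a).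
Proof.
move=> n0 a0 /[dup] qiab /andP[aqi qib].
rewrite storey_ofE// ?(le_trans (ltW aqi) qib)//; congr (_ / _).
rewrite (bigD1 i)//= [RHS](bigD1 i)//= qiab /zeroed eqxx ltNge a0/= add0r addrC.
by congr (_ + _); apply: eq_bigr => j /negbTE ->.
Qed.

End ecdf_of_sample.

Lemma measurable_ecdf_of (R : realType) (n : nat) d (S : measurableType d)
    (q : 'I_n -> S -> R) t : (forall i, measurable_fun setT (q i)) ->
  measurable_fun setT (fun s => ecdf_of (q^~ s) t).
Proof.
move=> mq; apply: measurable_funM => //; apply: measurable_sum => i.
by apply: measurable_natr_bool; exact: measurable_fun_ler.
Qed.

Lemma measurable_ecdf_functional (R : realType) (n : nat) (D : set R)
    d (S : measurableType d) d' (E : measurableType d') (q : 'I_n -> S -> R)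
    (g : (R -> R) -> E) :
  (forall i, measurable_fun setT (q i)) ->
  measurable_wrt (coordinates D R) g ->
  measurable_fun setT (fun s => g (ecdf_of (q^~ s))).
Proof.
move=> mq mg _ B mB; rewrite setTI.
have := measurable_wrt_path (X := fun t s => ecdf_of (q^~ s) t) mg mB.
apply: sub_measurable; apply: preimage_family_measurable => t _.
exact: measurable_ecdf_of.
Qed.

Lemma measurable_fun_inv (R : realType) d (S : measurableType d) (f : S -> R) :
  (forall s, 0 <= f s) -> measurable_fun setT f ->
  measurable_fun setT (fun s => (f s)^-1).
Proof.
(* The inverse of a nonnegative real, 0 included, is its power of exponent -1. *)
move=> f0 mf; under eq_fun do rewrite -powR_inv1//.
exact: (measurableT_comp (measurable_powR _) mf).
Qed.

(** Entry [i] is constant and the others do not involve [U i], so measurable quantities computed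
    from the zeroed sample can be frozen in [leave_one_out]. *)
Lemma measurable_zeroed d (T : measurableType d) (R : realType)
    (P : probability T R) (n : nat) (H : 'I_n -> {RV P >-> bool})
    (xi U : 'I_n -> {RV P >-> R}) i j :
  measurable_fun [set: g_sigma_algebraType (all_but H xi U i)]
    (fun w => zeroed i (fun j => pvalue H xi U j w) j).
Proof.
rewrite /zeroed; case: eqP => [_|/eqP ji]; first exact: measurable_cst.
exact: all_but_pvalue.
Qed.

Section model.
Context d (T : measurableType d) (R : realType) (P : probability T R) (n : nat).
Variables (H : 'I_n -> {RV P >-> bool}) (xi U : 'I_n -> {RV P >-> R}).
Local Notation q := (fun w j => pvalue H xi U j w).

Lemma pvalue_null i w : ~~ H i w -> pvalue H xi U i w = U i w.
Proof. by move=> /negbTE H0; rewrite /pvalue H0 subr0 mul1r mul0r addr0. Qed.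

Lemma measurable_pvalue i : measurable_fun setT (pvalue H xi U i).
Proof.
have mH : measurable_fun setT (fun w => (H i w)%:R : R).
  by apply: measurable_natr_bool; exact: measurable_funP.
apply: measurable_funD; apply: measurable_funM.
- by apply: measurable_funB; [exact: measurable_cst|exact: mH].
- exact: measurable_funP.
- exact: mH.
- exact: measurable_funP.
Qed.

Lemma measurable_ecdf t : measurable_fun setT (ecdf H xi U t).
Proof. by apply: measurable_ecdf_of => i; exact: measurable_pvalue. Qed.

Lemma ecdf_family_measurable D : preimage_family D (ecdf H xi U) `<=` measurable.
Proof. by apply: preimage_family_measurable => t _; exact: measurable_ecdf. Qed.

Lemma measurable_function_of_ecdf D m : measurable_function_of D (ecdf H xi U) m ->
  measurable_fun setT m.
Proof.
move=> [g mg mE]; rewrite (_ : m = fun w => g (ecdf_of (q w))); last exact/funext.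
apply: (measurable_ecdf_functional (q := pvalue H xi U)) mg => i.
exact: measurable_pvalue.
Qed.

Lemma false_rejectionsE t w : (false_rejections H xi U t w)%:R =
  \sum_(i < n) (~~ H i w)%:R * (U i w <= t)%R%:R :> R.
Proof.
rewrite /false_rejections natr_sum; apply: eq_bigr => i _.
rewrite -natrM mulnb andbC.
by case: (boolP (H i w)) => //= Hi; rewrite pvalue_null.
Qed.

Lemma measurable_false_rejections t :
  measurable_fun setT (fun w => (false_rejections H xi U t w)%:R : R).
Proof.
under eq_fun do rewrite false_rejectionsE.
apply: measurable_sum => i; apply: measurable_funM; apply: measurable_natr_bool.
- by apply: measurable_neg; exact: measurable_funP.
- by apply: measurable_fun_ler => //; exact: measurable_funP.
Qed.

End model.

(** * Conservativeness of the Storey estimator *)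

Section storey.
Context d (T : measurableType d) (R : realType) (P : probability T R) (n : nat).
Hypothesis n_gt0 : (0 < n)%N.
Variables (H : 'I_n -> {RV P >-> bool}) (xi U : 'I_n -> {RV P >-> R}).
Hypothesis BI : basic_independence H xi U.
Local Notation TG i := (g_sigma_algebraType (all_but H xi U i)).
Local Notation q := (fun w j => pvalue H xi U j w).
Local Notation z i := (fun w => zeroed i (q w)).
Variables (lambda a b : R).
Hypotheses (lambda_gt0 : 0 < lambda) (lambda_le : lambda <= a)
  (a_lt_b : a < b) (b_le1 : b <= 1).

Let a_ge0 : 0 <= a. Proof. exact: le_trans (ltW lambda_gt0) lambda_le. Qed.
Let b_ge0 : 0 <= b. Proof. exact: le_trans a_ge0 (ltW a_lt_b). Qed.

Variables (B : set (R -> R)) (mB : <<s coordinates `[b, 1] R >> B).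

(** The weight of the indicator of [U i w <= lambda] in V(lambda) over the Storey estimator,
    restricted to the event given by [B] and evaluated at the zeroed sample so as not to involve
    [U i]. *)
Let K i w : R := (~~ H i w)%:R * \1_B (ecdf_of (z i w)) / storey_of a b (z i w).

Let K_ge0 i w : 0 <= K i w.
Proof. by apply: divr_ge0; [exact: mulr_ge0|exact/ltW/storey_of_gt0]. Qed.

Let measurable_K i : measurable_fun [set: TG i] (K i).
Proof.
have mz := @measurable_zeroed _ _ _ _ _ H xi U i.
apply: measurable_funM; first apply: measurable_funM.
- by apply: measurable_natr_bool; apply: measurable_neg; exact: all_but_H.
- apply: (measurable_ecdf_functional (D := `[b, 1]%classic) mz).
  by apply/measurable_wrtE; exact: measurable_indic.
- apply: measurable_fun_inv => [w|]; first by rewrite ltW// storey_of_gt0.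
  apply: measurable_funM => //; apply: measurable_funM => //.
  apply: measurable_funD => //.
  by apply: measurable_funB; exact: measurable_ecdf_of.
Qed.

(** Zeroing a p-value that is at most [b] keeps the path on [b, 1], and [B] depends on nothing
    else. *)
Let indic_zeroed i w : ~~ H i w -> U i w <= b ->
  \1_B (ecdf_of (z i w)) = \1_B (ecdf_of (q w)) :> R.
Proof.
move=> Hi Ub; rewrite !indicE; congr (nat_of_bool _)%:R.
have zq t : `[b, 1]%classic t -> ecdf_of (z i w) t = ecdf_of (q w) t.
  rewrite /= in_itv/= => /andP[bt _]; rewrite ecdf_of_zeroed ?(le_trans b_ge0)//.
  by rewrite pvalue_null// (le_trans Ub).
have [zB Bz] := coordinates_saturated mB zq.
by apply/idP/idP => /[!inE].
Qed.

(** A true null with [U i w <= lambda] is below [a] before and after zeroing, so neither the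
    estimator nor the event changes. *)
Let sum_K_lambda w :
  (false_rejections H xi U lambda w)%:R / storey_estimator H xi U a b w
  * \1_B (ecdf_of (q w)) = \sum_(i < n) K i w * (U i w <= lambda)%R%:R.
Proof.
rewrite false_rejectionsE mulr_suml mulr_suml; apply: eq_bigr => i _.
rewrite /K; have [//|Hi] := boolP (H i w); first by rewrite !mul0r.
have [Ul|_] := leP (U i w) lambda; last by rewrite !(mulr0, mul0r).
rewrite !mul1r !mulr1 mulrC; congr (_ / _).
  by rewrite indic_zeroed// (le_trans Ul)// (le_trans lambda_le)// ltW.
by rewrite (storey_of_zeroed_le (t := lambda)) ?pvalue_null ?(ltW lambda_gt0)
  ?(ltW a_lt_b).
Qed.

(** For a true null with [a < U i w <= b], the zeroed estimator is [C / (b - a)], where [C] counts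
    the p-values in the interval. Each such null adds at most [(b - a) / C], and there are at most
    [C] of them. *)
Let sum_K_itv w : \sum_(i < n) K i w * (a < U i w <= b)%R%:R
  <= (b - a) * \1_B (ecdf_of (q w)).
Proof.
pose C : R := \sum_(j < n) (a < pvalue H xi U j w <= b)%R%:R.
apply: (@le_trans _ _ (\sum_(j < n) (a < pvalue H xi U j w <= b)%R%:R *
    (\1_B (ecdf_of (q w)) * ((b - a) / C)))).
  apply: ler_sum => i _; rewrite /K.
  have [|Hi] := boolP (H i w).
    rewrite !mul0r mulr_ge0// mulr_ge0// divr_ge0 ?subr_ge0 ?(ltW a_lt_b)//.
    exact: sumr_ge0.
  rewrite pvalue_null//; have [Uab|_] := boolP (a < U i w <= b); last first.
    by rewrite mulr0 mul0r.
  rewrite mul1r mulr1 mul1r indic_zeroed//; last by case/andP: Uab.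
  by rewrite storey_of_zeroed_itv ?pvalue_null// invf_div.
rewrite -mulr_suml -/C mulrCA mulrC ler_wpM2r//.
(* If the interval contains no p-value, the left-hand side is 0. *)
have [->|C0] := eqVneq C 0; first by rewrite mul0r subr_ge0 ltW.
by rewrite mulrC divfK.
Qed.

Lemma storey_bound :
  (\int[P]_(w in (fun w => ecdf_of (q w)) @^-1` B)
     ((false_rejections H xi U lambda w)%:R / storey_estimator H xi U a b w)%:E
   <= lambda%:E * P ((fun w => ecdf_of (q w)) @^-1` B))%E.
Proof.
set A := _ @^-1` B.
have mA : measurable A.
  have : <<s preimage_family `[b, 1] (ecdf H xi U) >> A.
    by rewrite preimage_family_path; exists B => //; rewrite setTI.
  exact/sub_measurable/ecdf_family_measurable.
have mU i (u : T -> bool) : measurable_fun setT u ->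
    measurable_fun setT (fun w => (K i w * (u w)%:R)%:E).
  move=> mu; apply/measurable_EFinP; apply: measurable_funM.
    exact: (sub_measurable_fun (@all_but_measurable _ _ _ _ _ H xi U i)).
  exact: measurable_natr_bool.
have mUle i t : measurable_fun setT (fun w => U i w <= t).
  by apply: measurable_fun_ler => //; exact: measurable_funP.
have mUitv i : measurable_fun setT (fun w => a < U i w <= b).
  apply: measurable_and; last exact: mUle.
  by apply: measurable_fun_ltr => //; exact: measurable_funP.
(* Both integrals freeze [K i]; the two indicators contribute their probabilities [lambda] and
   [b - a]. *)
have swap i : (\int[P]_w (K i w * (U i w <= lambda)%R%:R)%:E =
    (lambda / (b - a))%:E * \int[P]_w (K i w * (a < U i w <= b)%R%:R)%:E)%E.
  rewrite (leave_one_out_le BI (c := fun=> lambda))//; last first.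
    move=> _; rewrite (ltW lambda_gt0)/=.
    exact: le_trans lambda_le (le_trans (ltW a_lt_b) b_le1).
  rewrite (leave_one_out_itv BI)// -ge0_integralZl//.
  - apply: eq_integral => w _; rewrite -EFinM [K i w * (b - a)]mulrC mulrA divfK//.
      by rewrite mulrC.
    by rewrite subr_eq0 gt_eqF.
  - apply/measurable_EFinP/measurable_funM => //.
    exact: (sub_measurable_fun (@all_but_measurable _ _ _ _ _ H xi U i)).
  - by move=> w _; rewrite lee_fin mulr_ge0// subr_ge0 ltW.
  - by rewrite lee_fin divr_ge0// ?subr_ge0 ltW.
rewrite integral_mkcond epatch_indic.
under eq_integral => w _.
  rewrite /= -EFinM [_ * \1_A w](_ : _ = \sum_(i < n) K i w * (U i w <= lambda)%R%:R).
    rewrite -sumEFin; over.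
  by rewrite -sum_K_lambda.
rewrite ge0_integral_sum//=; last 2 first.
- by move=> i; exact: mU.
- by move=> i w _; rewrite lee_fin mulr_ge0.
rewrite (eq_bigr _ (fun i _ => swap i)) -ge0_sume_distrr; last first.
  by move=> i _; apply: integral_ge0 => w _; rewrite lee_fin mulr_ge0.
rewrite -ge0_integral_sum//=; last 2 first.
- by move=> i; exact: mU.
- by move=> i w _; rewrite lee_fin mulr_ge0.
(* The target gets the same factor [lambda / (b - a)], so that it remains to integrate
   [sum_K_itv]. *)
have -> : (lambda%:E * P A = (lambda / (b - a))%:E * \int[P]_w ((b - a) * \1_A w)%:E)%E.
  under eq_integral do rewrite EFinM.
  rewrite ge0_integralZl//; last 2 first.
  - exact/measurable_EFinP/measurable_indic.
  - by rewrite lee_fin subr_ge0 ltW.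
  rewrite integral_indic// setIT muleA -EFinM divfK//.
  by rewrite subr_eq0 gt_eqF.
apply: lee_wpmul2l; first by rewrite lee_fin divr_ge0// ?subr_ge0 ltW.
apply: ge0_le_integral => //.
- by move=> w _; apply: sume_ge0 => i _; rewrite lee_fin mulr_ge0.
- by apply: emeasurable_sum => i; exact: mU.
- apply/measurable_EFinP; apply: measurable_funM => //; exact: measurable_indic.
- by move=> w _; rewrite sumEFin lee_fin; exact: sum_K_itv.
Qed.

End storey.

Section storey_conservative.
Context d (T : measurableType d) (R : realType) (P : probability T R) (n : nat).
Hypothesis n_gt0 : (0 < n)%N.
Variables (H : 'I_n -> {RV P >-> bool}) (xi U : 'I_n -> {RV P >-> R}).
Hypothesis BI : basic_independence H xi U.

Lemma storey_conservative (lambda a b : R) :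
  0 < lambda -> lambda <= a -> a < b -> b <= 1 ->
  conservative_estimator H xi U lambda b (storey_estimator H xi U a b).
Proof.
move=> l0 la ab b1.
have m0 w : 0 < storey_estimator H xi U a b w by exact: storey_of_gt0.
have mm : measurable_function_of `[lambda, 1] (ecdf H xi U)
    (storey_estimator H xi U a b).
  exists (fun x => n%:R * ((x b - x a + n%:R^-1) / (b - a))) => // C mC.
  pose PT := g_sigma_algebraType (coordinates `[lambda, 1]%classic R).
  have mx t : `[lambda, 1]%classic t -> measurable_fun [set: PT] (fun x : PT => x t).
    move=> lt _ D mD; rewrite setTI; apply: sub_sigma_algebra.
    by exists t => //; exists D => //; rewrite setTI.
  have mg : measurable_fun [set: PT]
      (fun x : PT => n%:R * ((x b - x a + n%:R^-1) / (b - a))).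
    apply: measurable_funM => //; apply: measurable_funM => //.
    apply: measurable_funD => //; apply: measurable_funB; apply: mx.
      by rewrite /= in_itv/= b1 andbT (le_trans la) ?ltW.
    by rewrite /= in_itv/= la (le_trans (ltW ab)).
  by have := mg measurableT C mC; rewrite setTI.
split=> //.
apply: bounded_cond_expectation_le.
- exact: ecdf_family_measurable.
- apply: measurable_funM; first exact: measurable_false_rejections.
  apply: measurable_fun_inv => [w|]; first exact: ltW.
  exact: measurable_function_of_ecdf mm.
- by move=> w; rewrite divr_ge0// ltW.
- exact: ltW.
- move=> A; rewrite /ecdf_gen preimage_family_path => -[B mB <-].
  rewrite setTI; exact: storey_bound.
Qed.

End storey_conservative.

(** * The step up test *)

Section step_up.
Variables (R : realType) (n : nat).
Implicit Types (q : 'I_n -> R) (c : nat -> R).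

Definition nb_below q (x : R) : nat := (\sum_(i < n) (q i <= x)%R)%N.

(** The condition that the [j]-th order statistic is at most [c j] says that at least [j] p-values
    are; counts are easier to follow under zeroing than a sorted sample. *)
Definition rejections q c : nat :=
  (\max_(1 <= j < n.+1 | (j <= nb_below q (c j))%N) j)%N.

Lemma rejections_ge q c j : (j <= n)%N -> (j <= nb_below q (c j))%N ->
  (j <= rejections q c)%N.
Proof.
case: j => // j jn jq; rewrite /rejections big_mkcond.
rewrite (bigD1_seq j.+1) ?iota_uniq ?mem_index_iota ?ltnS//=.
by rewrite jq leq_maxl.
Qed.

Lemma rejectionsP q c : (rejections q c <= n)%N /\
  (rejections q c <= nb_below q (c (rejections q c)))%N.
Proof.
rewrite /rejections big_nat_cond; apply: (big_ind (fun r : nat =>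
  (r <= n)%N /\ (r <= nb_below q (c r))%N)) => //.
- by move=> x y; rewrite /maxn; case: ifP.
- by move=> j /andP[/andP[_ ?] ?].
Qed.

(** From the index [rejections q c] on, every critical value is at least [q i], so zeroing changes
    no count there. That index stays admissible and no larger one becomes so. *)
Lemma rejections_zeroed i q c : {homo c : j k / (j <= k)%N >-> j <= k} ->
  0 <= c 0%N -> q i <= c (rejections q c) ->
  rejections (zeroed i q) c = rejections q c.
Proof.
move=> c_le c0 qic.
have cge0 j : 0 <= c j by exact: le_trans c0 (c_le _ _ _).
have E j : (rejections q c <= j)%N -> nb_below (zeroed i q) (c j) = nb_below q (c j).
  move=> rj; apply: eq_bigr => k _; congr nat_of_bool.
  by rewrite zeroed_le// (le_trans qic)// c_le.
have [rn rq] := rejectionsP q c.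
have le1 : (rejections q c <= rejections (zeroed i q) c)%N.
  by apply: rejections_ge => //; rewrite E.
apply/eqP; rewrite eqn_leq le1 andbT.
by have [zn zq] := rejectionsP (zeroed i q) c; apply: rejections_ge; rewrite -?E.
Qed.

(** Induction on the sorted sequence: once the head exceeds [x], so does every later entry, and the
    count is 0. *)
Lemma sorted_nth_le (s : seq R) (x : R) (j : nat) : (0 < j <= size s)%N ->
  (nth 0 (sort <=%R s) j.-1 <= x) = (j <= count (fun y : R => (y <= x)%R) s)%N.
Proof.
case: j => // j /= js; set s' := sort _ s.
have ss : sorted <=%R s' by exact: (sort_sorted (@le_total _ R)).
have szs : size s' = size s by rewrite size_sort.
have <- : count (fun y : R => (y <= x)%R) s' = count (fun y : R => (y <= x)%R) s.
  by apply/permP; rewrite perm_sort.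
rewrite -szs in js; move: js ss; clearbody s'; clear.
elim: s' j => // y s IH j /= js ys.
have ss := path_sorted ys.
have [yx|xy] := leP y x.
  by case: j js => [|j] js; rewrite /= ?yx// ltnS IH.
have all_gt : all (fun u => x < u) (y :: s).
  rewrite /= xy; apply/allP => u us; apply: (lt_le_trans xy).
  by have /allP := order_path_min le_trans ys; apply.
have -> : count (fun u : R => (u <= x)%R) s = 0%N.
  apply/eqP; rewrite -leqn0 leqNgt -has_count; apply/hasPn => u us.
  by rewrite -ltNge; move/allP: all_gt; apply; rewrite inE us orbT.
rewrite addn0 ltn0; apply/negbTE; rewrite -ltNge.
by move/allP: all_gt; apply; exact: mem_nth.
Qed.

End step_up.

Lemma measurable_rejections (R : realType) (n : nat) d (S : measurableType d)
    (q : 'I_n -> S -> R) (c : nat -> S -> R) :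
  (forall i, measurable_fun setT (q i)) -> (forall j, measurable_fun setT (c j)) ->
  measurable_fun setT (fun s => rejections (q^~ s) (c^~ s)).
Proof.
move=> mq mc; rewrite /rejections.
have mnb j : measurable_fun setT (fun s => nb_below (q^~ s) (c j s)).
  rewrite /nb_below; elim: (index_enum _) => [|i r IH].
    by under eq_fun do rewrite big_nil; exact: measurable_cst.
  under eq_fun do rewrite big_cons; apply: measurable_fun_addn => //.
  by apply: (measurableT_comp (f := nat_of_bool)) => //; exact: measurable_fun_ler.
elim: (index_iota _ _) => [|j r IH].
  by under eq_fun do rewrite big_nil; exact: measurable_cst.
under eq_fun do rewrite big_cons.
apply: measurable_fun_ifT => //; last exact: measurable_fun_maxn.
exact: measurable_fun_leq.
Qed.

(** * Bounding the false discovery rate by leaving one out *)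

Section false_discovery_rate.
Context d (T : measurableType d) (R : realType) (P : probability T R) (n : nat).
Variables (H : 'I_n -> {RV P >-> bool}) (xi U : 'I_n -> {RV P >-> R}).
Hypothesis BI : basic_independence H xi U.
Local Notation TG i := (g_sigma_algebraType (all_but H xi U i)).
Local Notation q := (fun w j => pvalue H xi U j w).
Local Notation z i := (fun w => zeroed i (q w)).
Variables (lambda alpha : R) (m : T -> R).
Hypotheses (lambda_gt0 : 0 < lambda) (lambda_le1 : lambda <= 1).
Hypothesis alpha_gt0 : 0 < alpha.
Hypothesis m_gt0 : forall w, 0 < m w.
Variable g : (R -> R) -> R.
Hypothesis mg : measurable_wrt (coordinates `[lambda, 1] R) g.
Hypothesis mE : forall w, m w = g (ecdf_of (q w)).

Local Notation c := (adaptive_critical_value m alpha lambda).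

Lemma order_stat_le j w x : (0 < j <= n)%N ->
  (order_stat H xi U j w <= x) = (j <= nb_below (q w) x)%N.
Proof.
move=> jn; rewrite /order_stat sorted_nth_le; last by rewrite size_map -cardE card_ord.
rewrite count_map -sum1_count big_enum_cond big_mkcond; congr (_ <= _)%N.
Qed.

Lemma su_rejectionsE (c' : nat -> T -> R) w :
  su_rejections H xi U c' w = rejections (q w) (c'^~ w).
Proof.
rewrite /su_rejections /rejections big_nat_cond [RHS]big_nat_cond.
apply: eq_bigl => j; have [jn|//] := boolP (0 < j < n.+1)%N.
by rewrite order_stat_le.
Qed.

(* g is only known to be positive at the samples that occur, and the zeroed
   sample need not be one of them. *)
Let N (p : 'I_n -> R) : R := if 0 < g (ecdf_of p) then g (ecdf_of p) else 1.

Let N_gt0 p : 0 < N p.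
Proof. by rewrite /N; case: ifP. Qed.

Let NE w : N (q w) = m w.
Proof. by rewrite /N -mE m_gt0. Qed.

Let N_zeroed i p : p i <= lambda -> N (zeroed i p) = N p.
Proof.
move=> pil; rewrite /N.
rewrite (@coordinates_fun_eq R `[lambda, 1]%classic R _ _ g _ (ecdf_of p) mg)//.
move=> t; rewrite /= in_itv/= => /andP[lt _].
by rewrite ecdf_of_zeroed ?(le_trans pil)// (le_trans _ lt)// ltW.
Qed.

Let measurable_N i : measurable_fun [set: TG i] (fun w => N (z i w)).
Proof.
have mgz : measurable_fun [set: TG i] (fun w => g (ecdf_of (z i w))).
  exact: measurable_ecdf_functional (@measurable_zeroed _ _ _ _ _ H xi U i) mg.
by apply: measurable_fun_ifT => //; exact: measurable_fun_ltr.
Qed.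

(** The critical values as a function of the sample alone, so that they can be evaluated at a zeroed
    one. *)
Let crit p (j : nat) : R := Num.min (j%:R / N p * alpha) lambda.

Let crit_le p : {homo crit p : j k / (j <= k)%N >-> j <= k}.
Proof.
move=> j k jk; rewrite /crit le_min !ge_min lexx orbT andbT.
by rewrite ler_wpM2r ?(ltW alpha_gt0)// ler_wpM2r ?ler_nat// invr_ge0 ltW.
Qed.

Let crit0 p : crit p 0 = 0.
Proof. by rewrite /crit !mul0r min_l// ltW. Qed.

Let crit_ge0 p j : 0 <= crit p j.
Proof. by rewrite -(crit0 p) crit_le. Qed.

Let crit_lambda p j : crit p j <= lambda.
Proof. by rewrite /crit ge_min lexx orbT. Qed.

Let measurable_crit i j : measurable_fun [set: TG i] (fun w => crit (z i w) j).
Proof.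
apply: measurable_minr => //; apply: measurable_funM => //.
by apply: measurable_funM => //; apply: measurable_fun_inv => // w; exact: ltW.
Qed.

Let L i w : nat := rejections (z i w) (crit (z i w)).

Let measurable_L i : measurable_fun [set: TG i] (fun w => (L i w)%:R : R).
Proof.
apply: (measurableT_comp (f := fun k : nat => k%:R : R)) => //.
exact: (@measurable_rejections R n _ (TG i) (fun j w => z i w j)
  (fun j w => crit (z i w) j) (@measurable_zeroed _ _ _ _ _ H xi U i)
  (@measurable_crit i)).
Qed.

Let K i w : R := (~~ H i w)%:R / (L i w)%:R.

Let measurable_K i : measurable_fun [set: TG i] (K i).
Proof.
apply: measurable_funM; last exact: measurable_fun_inv.
by apply: measurable_natr_bool; apply: measurable_neg; exact: all_but_H.
Qed.

Let K_ge0 i w : 0 <= K i w.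
Proof. by rewrite divr_ge0. Qed.

Let threshold i w : R := crit (z i w) (L i w).

Let measurable_threshold i : measurable_fun [set: TG i] (threshold i).
Proof.
apply: measurable_minr => //; apply: measurable_funM => //.
by apply: measurable_funM => //; apply: measurable_fun_inv => // w; exact: ltW.
Qed.

(** If a true null [i] is rejected, [U i w] is at most the critical value reached, hence at most
    [lambda]. Zeroing then preserves the critical values, by [N_zeroed], and the number of
    rejections, by [rejections_zeroed], so this null contributes the inverse of [L i w]. *)
Let fdp_le w :
  (false_rejections H xi U (c (su_rejections H xi U c w) w) w)%:R
    / (maxn (su_rejections H xi U c w) 1)%:R
  <= \sum_(i < n) K i w * (U i w <= threshold i w)%R%:R.
Proof.
have cE j : c j w = crit (q w) j by rewrite /adaptive_critical_value /crit NE.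
have -> : su_rejections H xi U c w = rejections (q w) (crit (q w)).
  by rewrite su_rejectionsE; congr rejections; apply/funext.
set r := rejections _ _; rewrite cE false_rejectionsE mulr_suml.
apply: ler_sum => i _; rewrite /K; have [|Hi] := boolP (H i w); first by rewrite !mul0r.
rewrite !mul1r; have [Ur|_] := leP (U i w) (crit (q w) r); last first.
  by rewrite mul0r mulr_ge0.
have qr : q w i <= crit (q w) r by rewrite pvalue_null.
have critE : crit (z i w) = crit (q w).
  by apply/funext => j; rewrite /crit N_zeroed// (le_trans qr).
have LE : L i w = r.
  by rewrite /L critE rejections_zeroed ?crit0//; exact: crit_le.
rewrite /threshold LE critE Ur mulr1 mul1r.
have r_gt0 : (0 < r)%N.
  rewrite -LE; apply: rejections_ge; first exact: leq_ltn_trans (ltn_ord i).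
  by rewrite /nb_below (bigD1 i)//= /zeroed eqxx crit_ge0.
by rewrite (maxn_idPl r_gt0).
Qed.

Let measurable_m : measurable_fun setT m.
Proof.
apply: (@measurable_function_of_ecdf _ _ _ _ _ H xi U `[lambda, 1]%classic).
by exists g.
Qed.

Let measurable_c (r : T -> nat) : measurable_fun setT r ->
  measurable_fun setT (fun w => c (r w) w).
Proof.
move=> mr; apply: measurable_minr => //; apply: measurable_funM => //.
apply: measurable_funM; last by apply: measurable_fun_inv => // w; exact: ltW.
exact: (measurableT_comp (f := fun k : nat => k%:R : R)).
Qed.

Let measurable_U i : measurable_fun setT (U i).
Proof. exact: measurable_funP. Qed.

Let measurable_null i : measurable_fun setT (fun w => (~~ H i w)%:R : R).
Proof. by apply: measurable_natr_bool; apply: measurable_neg; exact: measurable_funP. Qed.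

Let measurable_su : measurable_fun setT (su_rejections H xi U c).
Proof.
rewrite (_ : su_rejections _ _ _ _ = fun w => rejections (q w) (c^~ w)).
  apply: (@measurable_rejections R n _ T (fun j w => q w j) c).
    by move=> i; exact: measurable_pvalue.
  by move=> j; exact: (measurable_c (r := fun=> j)).
by apply/funext => w; rewrite su_rejectionsE.
Qed.

Let measurable_fdp : measurable_fun setT (fun w =>
  (false_rejections H xi U (c (su_rejections H xi U c w) w) w)%:R
    / (maxn (su_rejections H xi U c w) 1)%:R : R).
Proof.
apply: measurable_funM.
  under eq_fun do rewrite false_rejectionsE.
  apply: measurable_sum => i; apply: measurable_funM => //.
  by apply: measurable_natr_bool; apply: measurable_fun_ler => //; exact: measurable_c.
apply: measurable_fun_inv => //.
apply: (measurableT_comp (f := fun k : nat => k%:R : R)) => //.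
exact: measurable_fun_maxn.
Qed.

(** Freezing replaces the indicator of a rejection by the threshold, which is at most
    [L / N * alpha]; the factor [L] cancels against that of [K] and leaves [alpha / N]. The constant
    threshold [lambda], used backwards, turns [lambda / N] into the contribution of one null to
    V(lambda) over [m]. *)
Lemma FDR_le :
  (FDR H xi U c <= (alpha / lambda)%:E *
     'E_P[fun w => ((false_rejections H xi U lambda w)%:R / m w)%R])%E.
Proof.
have TGT i (f : T -> R) : measurable_fun [set: TG i] f -> measurable_fun setT f.
  exact: (sub_measurable_fun (@all_but_measurable _ _ _ _ _ H xi U i)).
pose M i w : R := (~~ H i w)%:R / N (z i w).
have M0 i w : 0 <= M i w by rewrite divr_ge0// ltW.
have mM i : measurable_fun [set: TG i] (M i).
  apply: measurable_funM; last by apply: measurable_fun_inv => // w; exact: ltW.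
  by apply: measurable_natr_bool; apply: measurable_neg; exact: all_but_H.
have bound i : (\int[P]_w (K i w * (U i w <= threshold i w)%R%:R)%:E <=
    (alpha / lambda)%:E * \int[P]_w (M i w * (U i w <= lambda)%R%:R)%:E)%E.
  rewrite (leave_one_out_le BI)//; last first.
    by move=> w; rewrite crit_ge0 (le_trans (crit_lambda _ _)).
  rewrite (leave_one_out_le BI (c := fun=> lambda))//; last by move=> _; rewrite ltW.
  rewrite -ge0_integralZl//; last 3 first.
  - by apply/measurable_EFinP/measurable_funM => //; exact: TGT.
  - by move=> w _; rewrite lee_fin mulr_ge0// ltW.
  - by rewrite lee_fin divr_ge0// ltW.
  apply: ge0_le_integral => //.
  - by move=> w _; rewrite lee_fin mulr_ge0// crit_ge0.
  - by apply/measurable_EFinP/measurable_funM; exact: TGT.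
  - apply/measurable_EFinP; apply: measurable_funM => //; apply: measurable_funM => //.
    exact: TGT.
  move=> w _; rewrite -EFinM lee_fin.
  have -> : alpha / lambda * (M i w * lambda) = (~~ H i w)%:R * (alpha / N (z i w)).
    by rewrite mulrCA divfK ?gt_eqF// /M -mulrA [_^-1 * _]mulrC.
  rewrite /K -mulrA ler_wpM2l//.
  (* The inverse of 0 is 0, so the bound is trivial for [L i w = 0]. *)
  have [->|L0] := posnP (L i w); first by rewrite invr0 mul0r divr_ge0// ltW.
  apply: (@le_trans _ _ ((L i w)%:R^-1 * ((L i w)%:R / N (z i w) * alpha))).
    by rewrite ler_wpM2l// /threshold /crit ge_min lexx.
  by rewrite !mulrA mulVf ?pnatr_eq0 -?lt0n// mul1r mulrC.
rewrite /FDR unlock.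
apply: (@le_trans _ _
  (\int[P]_w (\sum_(i < n) (K i w * (U i w <= threshold i w)%R%:R)%:E))%E).
  apply: ge0_le_integral => //.
  - exact/measurable_EFinP.
  - apply: emeasurable_sum => i; apply/measurable_EFinP/measurable_funM; first exact: TGT.
    by apply: measurable_natr_bool; apply: measurable_fun_ler => //; exact: TGT.
  - by move=> w _; rewrite sumEFin lee_fin.
have mKU i : measurable_fun setT
    (fun w => (K i w * (U i w <= threshold i w)%R%:R)%:E).
  apply/measurable_EFinP/measurable_funM; first exact: TGT.
  by apply: measurable_natr_bool; apply: measurable_fun_ler => //; exact: TGT.
have mMU i : measurable_fun setT (fun w => (M i w * (U i w <= lambda)%R%:R)%:E).
  apply/measurable_EFinP/measurable_funM; first exact: TGT.
  by apply: measurable_natr_bool; apply: measurable_fun_ler.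
rewrite ge0_integral_sum//; last by move=> i w _; rewrite lee_fin mulr_ge0.
apply: (le_trans (lee_sum _ (fun i _ => bound i))).
rewrite -ge0_sume_distrr; last first.
  by move=> i _; apply: integral_ge0 => w _; rewrite lee_fin mulr_ge0.
rewrite -ge0_integral_sum//; last by move=> i w _; rewrite lee_fin mulr_ge0.
rewrite le_eqVlt; apply/orP; left; apply/eqP; congr (_ * _)%E.
apply: eq_integral => w _; rewrite sumEFin false_rejectionsE mulr_suml; congr EFin.
(* For [U i w <= lambda] the zeroed estimator coincides with [m w]. *)
apply: eq_bigr => i _; rewrite /M; have [|Hi] := boolP (H i w); first by rewrite !mul0r.
have [Ul|_] := leP (U i w) lambda; last by rewrite !(mulr0, mul0r).
by rewrite !mul1r mulr1 N_zeroed ?NE// pvalue_null.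
Qed.

End false_discovery_rate.

(** * Convex combinations of estimators *)

Lemma measurable_function_of_wrt (T : Type) (R : realType) (D : set R)
    (X : R -> T -> R) (Y : T -> R) :
  measurable_function_of D X Y -> measurable_wrt (preimage_family D X) Y.
Proof.
move=> [g mg YE]; rewrite (_ : Y = fun w => g (fun t => X t w)); last exact/funext.
exact: measurable_wrt_path.
Qed.

Lemma measurable_wrtS (T : Type) d (E : measurableType d) (F G : set (set T))
    (f : T -> E) : F `<=` G -> measurable_wrt F f -> measurable_wrt G f.
Proof. by move=> FG mf B /mf; exact: sub_sigma_algebra2. Qed.

(* Convexity of the inverse, through its tangent at the barycenter. *)
Lemma inv_barycenter_le (R : realFieldType) (k : nat) (b m : 'I_k -> R) :
  (forall i, 0 <= b i) -> \sum_i b i = 1 -> (forall i, 0 < m i) ->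
  (\sum_i b i * m i)^-1 <= \sum_i b i / m i.
Proof.
move=> b0 b1 m0; set s := \sum_i b i * m i.
(* A nonpositive barycenter would have a nonpositive inverse, below the nonnegative right-hand
   side. *)
have [s0|s0] := leP s 0.
  apply: (@le_trans _ _ 0); first by rewrite invr_le0.
  by apply: sumr_ge0 => i _; rewrite divr_ge0// ltW.
have tangent i : 2 / s - m i / s ^+ 2 <= (m i)^-1.
  have mi0 := m0 i; rewrite -subr_ge0.
  have -> : (m i)^-1 - (2 / s - m i / s ^+ 2) = (s - m i) ^+ 2 / (m i * s ^+ 2).
    by field; rewrite !gt_eqF.
  by rewrite divr_ge0 ?sqr_ge0// mulr_ge0 ?sqr_ge0// ltW.
apply: (@le_trans _ _ (\sum_i b i * (2 / s - m i / s ^+ 2))).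
  under eq_bigr do rewrite mulrBr !mulrA.
  rewrite sumrB -!mulr_suml b1 mul1r -/s.
  by rewrite le_eqVlt; apply/orP; left; apply/eqP; field; rewrite gt_eqF.
by apply: ler_sum => i _; rewrite ler_wpM2l.
Qed.

Theorem theorem7 (d : measure_display) (T : measurableType d) (R : realType)
    (P : probability T R) (n : nat) (n_ge1 : (1 <= n)%N)
    (H : 'I_n -> {RV P >-> bool}) (xi U : 'I_n -> {RV P >-> R})
    (BI : basic_independence H xi U)
    (k : nat) (k_ge1 : (1 <= k)%N) (lambda alpha : R) (gamma : 'I_k -> R)
    (lambda_gt0 : 0 < lambda)
    (lambda_lt_gamma : forall i, lambda < gamma i)
    (gamma_le : forall i j : 'I_k, (i <= j)%N -> gamma i <= gamma j)
    (gamma_le1 : forall i, gamma i <= 1)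
    (alpha_gt0 : 0 < alpha) (alpha_lt_lambda : alpha < lambda) :
  (forall (i : 'I_k) (lambda_i : R), lambda <= lambda_i < gamma i ->
     conservative_estimator H xi U lambda (gamma i)
       (storey_estimator H xi U lambda_i (gamma i)))
  /\
  (forall (beta m : 'I_k -> T -> R),
     (forall i w, 0 <= beta i w) ->
     (forall w, \sum_(i < k) beta i w = 1) ->
     (forall i, measurable_wrt (ecdf_gen H xi U (gamma i)) (beta i)) ->
     (forall i, conservative_estimator H xi U lambda (gamma i) (m i)) ->
     let n0 := fun w => \sum_(i < k) beta i w * m i w in
     ('E_P[fun w => ((false_rejections H xi U lambda w)%:R / n0 w)%R]
        <= lambda%:E)%E
     /\ (FDR H xi U (adaptive_critical_value n0 alpha lambda)
           <= alpha%:E)%E).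
Proof.
split=> [i a /andP[la ag]|beta m beta0 beta1 mbeta m_cons n0].
  exact: storey_conservative.
have m0 i w : 0 < m i w by case: (m_cons i).
have beta_le1 i w : 0 <= beta i w <= 1.
  rewrite beta0/= -(beta1 w) (bigD1 i)//= lerDl; exact: sumr_ge0.
have n0_gt0 w : 0 < n0 w.
  rewrite lt_neqAle eq_sym sumr_ge0 ?andbT; last first.
    by move=> i _; rewrite mulr_ge0// ltW.
  (* If the sum of these nonnegative terms vanished, every weight would be 0, although the weights
     sum to 1. *)
  apply/eqP => /eqP; rewrite psumr_eq0; last by move=> i _; rewrite mulr_ge0// ltW.
  move=> /allP bm0; have := beta1 w; rewrite big1 => [/esym/eqP|i _].
    by rewrite oner_eq0.
  have := bm0 i (mem_index_enum i); rewrite /= mulf_eq0 [m i w == 0]gt_eqF// orbF.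
  exact: eqP.
have lambda_le1 : lambda <= 1.
  by rewrite (le_trans (ltW (lambda_lt_gamma (Ordinal k_ge1)))).
pose X w : R := (false_rejections H xi U lambda w)%:R.
have mX : measurable_fun setT X by exact: measurable_false_rejections.
have mm i : measurable_fun setT (m i).
  by case: (m_cons i) => _ /measurable_function_of_ecdf.
have Gm t : ecdf_gen H xi U t `<=` measurable by exact: ecdf_family_measurable.
have mb i : measurable_fun setT (beta i).
  by have /measurable_wrtE/(sub_measurable_fun (Gm _)) := mbeta i.
have mn0 : measurable_fun setT n0.
  by apply: measurable_sum => i; exact: measurable_funM.
have mXm i : measurable_fun setT (fun w => X w / m i w).
  by apply: measurable_funM => //; apply: measurable_fun_inv => // w; exact: ltW.
have Xm0 i w : 0 <= X w / m i w by rewrite divr_ge0// ltW.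
(* The law of one of the uniforms serves as the auxiliary measure of the layer cake formula; [n_ge1]
   provides its index. *)
have nu_lt (x : R) : 0 <= x <= 1 ->
    distribution P (U (Ordinal n_ge1)) `]-oo, x[%classic = x%:E.
  by move=> x01; rewrite (U_uniform BI)// uniform_prob01_lt.
have bound : ('E_P[fun w => (X w / n0 w)%R] <= lambda%:E)%E.
  rewrite unlock.
  apply: (@le_trans _ _ (\int[P]_w \sum_(i < k) (beta i w * (X w / m i w))%:E)%E).
    apply: ge0_le_integral => //.
    - by move=> w _; rewrite lee_fin divr_ge0// ltW.
    - apply/measurable_EFinP/measurable_funM => //.
      by apply: measurable_fun_inv => // w; exact: ltW.
    - by apply: emeasurable_sum => i; apply/measurable_EFinP/measurable_funM.
    move=> w _; rewrite sumEFin lee_fin.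
    under eq_bigr do rewrite mulrCA.
    by rewrite -mulr_sumr ler_wpM2l// inv_barycenter_le.
  rewrite ge0_integral_sum//; last 2 first.
  - by move=> i; apply/measurable_EFinP/measurable_funM.
  - by move=> i w _; rewrite lee_fin mulr_ge0.
  (* Each weight is measurable for the sigma-algebra on which its own estimator is conditioned, so
     the conditional bound can be integrated against it. *)
  apply: (@le_trans _ _ (\sum_(i < k) lambda%:E * \int[P]_w (beta i w)%:E)%E).
    apply: lee_sum => i _.
    apply: (weighted_integral_le (G := ecdf_gen H xi U (gamma i)) _ _ _ _ _ nu_lt) => //.
    - exact: ltW.
    - move=> A; apply: cond_expectation_le_integral => //; first exact: ltW.
      by case: (m_cons i).
  rewrite -ge0_sume_distrr; last first.
    by move=> i _; apply: integral_ge0 => w _; rewrite lee_fin.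
  rewrite -ge0_integral_sum//; last 2 first.
  - by move=> i; exact/measurable_EFinP.
  - by move=> i w _; rewrite lee_fin.
  under eq_integral do rewrite sumEFin beta1.
  rewrite integral_cst// mul1e [X in (_ * X)%E](_ : _ = 1%E) ?mule1//.
  exact: probability_setT.
split=> //.
(* As [lambda < gamma i], the weights are measurable for the path on [lambda, 1] as well;
   factorization then exhibits [n0] as a function of this path, as [FDR_le] demands. *)
have [g mg gE] : measurable_function_of `[lambda, 1] (ecdf H xi U) n0.
  apply: measurable_factorization => [w|]; first exact: ltW.
  apply/measurable_wrtE; apply: measurable_sum => i; apply: measurable_funM.
    apply/measurable_wrtE; apply: measurable_wrtS (mbeta i).
    apply: preimage_familyS => t /=; rewrite !in_itv/= => /andP[gt ->].
    by rewrite (le_trans (ltW (lambda_lt_gamma i)) gt).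
  by apply/measurable_wrtE; apply: measurable_function_of_wrt; case: (m_cons i).
apply: (le_trans (FDR_le BI lambda_gt0 lambda_le1 alpha_gt0 n0_gt0 mg gE)).
apply: (le_trans (lee_wpmul2l _ bound)); first by rewrite lee_fin divr_ge0// ltW.
by rewrite -EFinM divfK ?gt_eqF.
Qed.
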